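(* Let $>$ be a ground-total reduction order and let $\Gamma\colon(\mathcal{E}_0,\mathcal{R}_0)\vdash_{\mathsf o}(\mathcal{E}_1,\mathcal{R}_1)\vdash_{\mathsf o}(\mathcal{E}_2,\mathcal{R}_2)\vdash_{\mathsf o}\cdots$ be an infinite run of ordered completion $\mathsf{KB_o}$ with respect to $>$, with $\mathcal{R}_0=\varnothing$. If $\Gamma$ is fair and $\mathcal{E}_\omega=\varnothing$ then $\mathcal{R}_\omega$ is a complete presentation of $\mathcal{E}_0$.
   Context: Terms are built from a signature $\mathcal{F}$ and an infinite set of variables. An ES is a set of pairs of terms $s\approx t$; a TRS is a set of pairs $\ell\to r$ with $\ell$ not a variable and every variable of $r$ occurring in $\ell$. For a set $X$ of pairs of terms, $X^{\pm}=X\cup X^{-1}$, $\to_X$ is the closure of $X$ under contexts and substitutions, $\leftrightarrow_X$ its symmetric closure, $\leftrightarrow_X^*$ the conversion relation, and $\downarrow_X\,=\,\to_X^*\cdot{}_X^*{\leftarrow}$ joinability. A reduction order is a well-founded strict order on terms closed under contexts and substitutions; it is ground-total if any two distinct ground terms are comparable. A TRS is complete if it is terminating and confluent (on all terms); $\mathcal{R}$ is a complete presentation of $\mathcal{E}$ if $\mathcal{R}$ is complete and $\leftrightarrow_{\mathcal{R}}^*\,=\,\leftrightarrow_{\mathcal{E}}^*$. For an ES $\mathcal{E}$, $\mathcal{E}^>$ is the set of rules $\ell\sigma\to r\sigma$ with $\ell\approx r\in\mathcal{E}^\pm$, $\sigma$ a substitution, and $\ell\sigma>r\sigma$. A term $s$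 encompasses $t$ if $s=C[t\sigma]$ for some $C,\sigma$; properly, if moreover $t$ does not encompass $s$. Write $t\to^{\rhd}_{\mathcal{R}}u$ if $t\to u$ using a rule $\ell\to r\in\mathcal{R}$ with $t$ properly encompassing $\ell$, and $t\to^{\rhd}_{\mathcal{E}^>}u$ if there are $\ell\approx r\in\mathcal{E}^\pm$, $C$, $\sigma$ with $t=C[\ell\sigma]$, $u=C[r\sigma]$, $\ell\sigma>r\sigma$, and $t$ properly encompasses $\ell$. Inference system $\mathsf{KB_o}$ ($\uplus$ is disjoint union): $(\mathcal{E},\mathcal{R})\vdash_{\mathsf o}(\mathcal{E}',\mathcal{R}')$ if it is an instance of one of - deduce: $(\mathcal{E},\mathcal{R})\vdash(\mathcal{E}\cup\{s\approx t\},\mathcal{R})$ if $s\,{}_{\mathcal{R}\cup\mathcal{E}^\pm}{\leftarrow}\cdot\to_{\mathcal{R}\cup\mathcal{E}^\pm}t$; - orient: $(\mathcal{E}\uplus\{s\approx t\},\mathcal{R})\vdash(\mathcal{E},\mathcal{R}\cup\{s\to t\})$ if $s>t$, and $(\mathcal{E}\uplus\{s\approx t\},\mathcal{R})\vdash(\mathcal{E},\mathcal{R}\cup\{t\to s\})$ if $t>s$; - delete: $(\mathcal{E}\uplus\{s\approx s\},\mathcal{R})\vdash(\mathcal{E},\mathcal{R})$; - compose: $(\mathcal{E},\mathcal{R}\uplus\{s\to t\})\vdash(\mathcal{E},\mathcal{R}\cup\{s\to u\})$ if $t\to_{\mathcal{E}^>\cup\mathcal{R}}u$; - simplify: $(\mathcal{E}\uplus\{s\approx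 t\},\mathcal{R})\vdash(\mathcal{E}\cup\{u\approx t\},\mathcal{R})$ if $s\to_{\mathcal{R}}u$ or $s\to^{\rhd}_{\mathcal{E}^>}u$, and $(\mathcal{E}\uplus\{s\approx t\},\mathcal{R})\vdash(\mathcal{E}\cup\{s\approx u\},\mathcal{R})$ if $t\to_{\mathcal{R}}u$ or $t\to^{\rhd}_{\mathcal{E}^>}u$; - collapse: $(\mathcal{E},\mathcal{R}\uplus\{t\to s\})\vdash(\mathcal{E}\cup\{u\approx s\},\mathcal{R})$ if $t\to^{\rhd}_{\mathcal{R}}u$ or $t\to^{\rhd}_{\mathcal{E}^>}u$. For an infinite run put $\mathcal{E}_\infty=\bigcup_{i}\mathcal{E}_i$, $\mathcal{E}_\omega=\bigcup_{i}\bigcap_{j\ge i}\mathcal{E}_j$, $\mathcal{R}_\omega=\bigcup_{i}\bigcap_{j\ge i}\mathcal{R}_j$, $\mathcal{S}_\omega=\mathcal{E}_\omega^>\cup\mathcal{R}_\omega$. Extended prime critical pairs: an extended overlap of an ES $\mathcal{E}$ is a triple $\langle\ell_1\approx r_1,p,\ell_2\approx r_2\rangle$ where both equations are variants (up to renaming) of equations in $\mathcal{E}^\pm$ without common variables, $p$ is a non-variable position of $\ell_2$, $\ell_1$ and $\ell_2|_p$ are unifiable with mgu $\mu$, $r_1\mu\not>\ell_1\mu$ and $r_2\mu\not>\ell_2\mu$. It gives the extended critical pair $\ell_2[r_1]_p\mu\approx r_2\mu$, which is prime if all proper subterms of $\ell_1\mu$ are $\mathcal{E}^>$-normal forms. $\mathrm{PCP}_>(\mathcal{E})$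 is the set of extended prime critical pairs of $\mathcal{E}$ (rules of $\mathcal{R}_\omega$ are viewed as equations in $\mathcal{E}_\omega\cup\mathcal{R}_\omega$). The run is fair if $\mathrm{PCP}_>(\mathcal{E}_\omega\cup\mathcal{R}_\omega)\subseteq{\downarrow_{\mathcal{S}_\omega}}\cup{\leftrightarrow_{\mathcal{E}_\infty}}$. *)

(* Defs.v *)
From Stdlib Require Import Relations.
From mathcomp Require Import all_boot.
From mathcomp Require Import boolp classical_sets functions cardinality.

Set Implicit Arguments.
Unset Strict Implicit.
Unset Printing Implicit Defensive.

Local Open Scope classical_set_scope.

Record signature := Signature { symbol :> Type; arity : symbol -> nat }.

Inductive term (F : signature) (V : Type) : Type :=
| Var of V
| Fun (f : F) of ('I_(arity f) -> term F V).

(* In [CFun f i ts C] the hole lies in argument [i]; the value [ts i] is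
   irrelevant. *)
Inductive context (F : signature) (V : Type) : Type :=
| Hole
| CFun (f : F) (i : 'I_(arity f)) of ('I_(arity f) -> term F V) & context F V.

Arguments Var {F V} x.
Arguments Fun {F V} f ts.
Arguments Hole {F V}.
Arguments CFun {F V} f i ts C.

Section Terms.
Context {F : signature} {V : Type}.
Local Notation tm := (term F V).

Fixpoint vars (t : tm) : set V :=
  match t with
  | Var x => [set x]
  | Fun f ts => \bigcup_(i in [set: 'I_(arity f)]) vars (ts i)
  end.

Definition ground (t : tm) : Prop := vars t = set0.

Definition is_var (t : tm) : Prop := exists x, t = Var x.

(* A substitution is any function from variables to terms, with no finiteness
   condition on its domain: only its values on the finitely many variables of
   the terms it is applied to matter. *)
Fixpoint subst (σ : V -> tm) (t : tm) : tm :=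
  match t with
  | Var x => σ x
  | Fun f ts => Fun f (fun i => subst σ (ts i))
  end.

Fixpoint fill (C : context F V) (t : tm) : tm :=
  match C with
  | Hole => t
  | CFun f i ts C' => Fun f (fun j => if j == i then fill C' t else ts j)
  end.

(* Positions are sequences of argument indices, counted from 0. *)
Fixpoint subterm_at (t : tm) (p : seq nat) {struct p} : option tm :=
  match p, t with
  | [::], _ => Some t
  | k :: q, Fun f ts =>
      if insub k is Some i then subterm_at (ts i) q else None
  | _ :: _, Var _ => None
  end.

(* [replace_at t p u] is [t] if [p] is not a position of [t]. *)
Fixpoint replace_at (t : tm) (p : seq nat) (u : tm) {struct p} : tm :=
  match p, t with
  | [::], _ => u
  | k :: q, Fun f ts =>
      Fun f (fun i => if val i == k then replace_at (ts i) q u else ts i)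
  | _ :: _, Var x => Var x
  end.

Definition proper_subterm (u t : tm) : Prop :=
  exists p, p <> [::] /\ subterm_at t p = Some u.

Definition encompasses (s t : tm) : Prop :=
  exists C σ, s = fill C (subst σ t).

Definition properly_encompasses (s t : tm) : Prop :=
  encompasses s t /\ ~ encompasses t s.

End Terms.

Section Rewriting.
Context {F : signature} {V : Type}.
Local Notation tm := (term F V).
Local Notation pairs := (set (tm * tm)).
Implicit Types (X E R : pairs) (gt : relation tm).

Definition is_TRS R : Prop :=
  forall l r, R (l, r) -> ~ is_var l /\ vars r `<=` vars l.

Definition sym X : pairs := X `|` [set e | X (e.2, e.1)].

Definition rstep X : relation tm := fun s t =>
  exists l r C σ,
    [/\ X (l, r), s = fill C (subst σ l) & t = fill C (subst σ r)].

Definition sstep X : relation tm := fun s t => rstep X s t \/ rstep X t s.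

Definition conversion X : relation tm := clos_refl_trans tm (sstep X).

Definition rsteps X : relation tm := clos_refl_trans tm (rstep X).

Definition joinable X : relation tm := fun s t =>
  exists u, rsteps X s u /\ rsteps X t u.

Definition normal_form X (t : tm) : Prop := ~ exists u, rstep X t u.

Definition terminating X : Prop := well_founded (fun u t => rstep X t u).

Definition confluent X : Prop :=
  forall s t u, rsteps X s t -> rsteps X s u -> joinable X t u.

Definition complete R : Prop := [/\ is_TRS R, terminating R & confluent R].

Definition complete_presentation R E : Prop :=
  complete R /\ (forall s t, conversion R s t <-> conversion E s t).

Record reduction_order gt : Prop := ReductionOrder {
  gt_irrefl : forall s, ~ gt s s;
  gt_trans : forall s t u, gt s t -> gt t u -> gt s u;
  gt_wf : well_founded (fun t s => gt s t);
  gt_fill : forall C s t, gt s t -> gt (fill C s) (fill C t);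
  gt_subst : forall σ s t, gt s t -> gt (subst σ s) (subst σ t)
}.

Definition ground_total gt : Prop :=
  forall s t, ground s -> ground t -> s <> t -> gt s t \/ gt t s.

(* The rules of E^>. *)
Definition ordered gt E : pairs := [set e | exists l r σ,
  [/\ sym E (l, r), gt (subst σ l) (subst σ r) &
      e = (subst σ l, subst σ r)]].

Definition pe_step R : relation tm := fun t u =>
  exists l r C σ,
    [/\ R (l, r), t = fill C (subst σ l), u = fill C (subst σ r) &
        properly_encompasses t l].

(* Not [pe_step (ordered gt E)]: it is the left-hand side of the equation, not
   of its ordered instance, that has to be properly encompassed. *)
Definition pe_ostep gt E : relation tm := fun t u =>
  exists l r C σ,
    [/\ sym E (l, r), t = fill C (subst σ l), u = fill C (subst σ r),
        gt (subst σ l) (subst σ r) & properly_encompasses t l].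

Inductive KBo gt : relation (pairs * pairs) :=
| KBo_deduce E R u s t :
    rstep (R `|` sym E) u s -> rstep (R `|` sym E) u t ->
    KBo gt (E, R) (E `|` [set (s, t)], R)
| KBo_orientl E R s t : ~ E (s, t) -> gt s t ->
    KBo gt (E `|` [set (s, t)], R) (E, R `|` [set (s, t)])
| KBo_orientr E R s t : ~ E (s, t) -> gt t s ->
    KBo gt (E `|` [set (s, t)], R) (E, R `|` [set (t, s)])
| KBo_delete E R s : ~ E (s, s) ->
    KBo gt (E `|` [set (s, s)], R) (E, R)
| KBo_compose E R s t u : ~ R (s, t) ->
    rstep (ordered gt E `|` R) t u ->
    KBo gt (E, R `|` [set (s, t)]) (E, R `|` [set (s, u)])
| KBo_simplifyl E R s t u : ~ E (s, t) ->
    rstep R s u \/ pe_ostep gt E s u ->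
    KBo gt (E `|` [set (s, t)], R) (E `|` [set (u, t)], R)
| KBo_simplifyr E R s t u : ~ E (s, t) ->
    rstep R t u \/ pe_ostep gt E t u ->
    KBo gt (E `|` [set (s, t)], R) (E `|` [set (s, u)], R)
| KBo_collapse E R t s u : ~ R (t, s) ->
    pe_step R t u \/ pe_ostep gt E t u ->
    KBo gt (E, R `|` [set (t, s)]) (E `|` [set (u, s)], R).

Definition all_along (X : nat -> pairs) : pairs := \bigcup_i X i.

Definition persistent (X : nat -> pairs) : pairs :=
  \bigcup_i \bigcap_(j in [set j | (i <= j)%N]) X j.

Definition variant (e e' : tm * tm) : Prop :=
  exists ρ : V -> V, bijective ρ /\
    e = (subst (Var \o ρ) e'.1, subst (Var \o ρ) e'.2).

Definition unifier (σ : V -> tm) (s t : tm) : Prop := subst σ s = subst σ t.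

Definition mgu (μ : V -> tm) (s t : tm) : Prop :=
  unifier μ s t /\
  forall τ, unifier τ s t -> exists δ, forall x, τ x = subst δ (μ x).

(* The overlap [<l1 ≈ r1, p, l2 ≈ r2>], together with a choice [μ] of mgu. *)
Definition extended_overlap gt E (l1 r1 : tm) (p : seq nat) (l2 r2 : tm)
    (μ : V -> tm) : Prop :=
  [/\ exists2 e, sym E e & variant (l1, r1) e,
      exists2 e, sym E e & variant (l2, r2) e,
      (vars l1 `|` vars r1) `&` (vars l2 `|` vars r2) = set0,
      exists u, [/\ subterm_at l2 p = Some u, ~ is_var u & mgu μ l1 u] &
      ~ gt (subst μ r1) (subst μ l1) /\ ~ gt (subst μ r2) (subst μ l2)].

Definition PCP gt E : pairs := [set e | exists l1 r1 p l2 r2 μ,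
  [/\ extended_overlap gt E l1 r1 p l2 r2 μ,
      forall u, proper_subterm u (subst μ l1) -> normal_form (ordered gt E) u &
      e = (subst μ (replace_at l2 p r1), subst μ r2)]].

Definition KBo_run gt (E R : nat -> pairs) : Prop :=
  forall i, KBo gt (E i, R i) (E i.+1, R i.+1).

Definition fair gt (E R : nat -> pairs) : Prop :=
  forall s t, PCP gt (persistent E `|` persistent R) (s, t) ->
    joinable (ordered gt (persistent E) `|` persistent R) s t \/
    sstep (all_along E) s t.

End Rewriting.

(* Main.v *)
(** Call [s] and [t] connected if they are convertible by persistent rules
    through terms each of which is [s] or [t] or below one of them in [>].  This
    relation is closed under contexts and substitutions.  Since no equation
    persists, every equation of the run, and every non-persistent rule, is
    eventually removed by an inference whose premises are smaller, so that all of
    them are connected, by well-founded induction on the union of [>] and proper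
    encompassment (where encompassment followed by [>] is [>] followed by
    encompassment).  Hence by fairness all prime critical pairs of the persistent
    rules are connected.  A non-prime critical peak splits at an innermost redex
    into two peaks that are prime or variable overlaps, so every local peak
    converts below its source, which together with termination yields
    confluence. *)

From Stdlib Require Import Relations.
From Stdlib Require Eqdep.
From mathcomp Require Import all_boot.
From mathcomp Require Import boolp classical_sets functions cardinality.
Require Import Defs.

Set Implicit Arguments.
Unset Strict Implicit.
Unset Printing Implicit Defensive.

Local Open Scope classical_set_scope.

(** * Terms, unification and encompassment *)

Section Terms.
Context {F : signature} {V : Type}.
Local Notation tm := (term F V).
Local Notation ctx := (context F V).
Implicit Types (s t u : tm) (C D : ctx) (σ τ : V -> tm).

(** The type of the arguments depends on the symbol, so injectivity of the constructor only equates
    dependent pairs; uniqueness of identity proofs does the rest. *)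
Lemma Fun_inj (f : F) (ss ts : 'I_(arity f) -> tm) :
  Fun f ss = Fun f ts -> ss = ts.
Proof. by case=> /(@Eqdep.EqdepTheory.inj_pair2 _ _ _ _ _). Qed.

Lemma vars_FunP (f : F) (ts : 'I_(arity f) -> tm) x :
  vars (Fun f ts) x <-> exists i, vars (ts i) x.
Proof. by split=> [[i _ tix]|[i tix]]; exists i. Qed.

Lemma eq_subst σ τ t :
  (forall x, vars t x -> σ x = τ x) -> subst σ t = subst τ t.
Proof.
elim: t => [x|f ts IH] /= eqστ; first exact: eqστ.
congr Fun; apply: funext => i; apply: IH => x tix.
by apply: eqστ; exists i.
Qed.

Lemma subst_id t : subst Var t = t.
Proof. by elim: t => //= f ts IH; congr Fun; apply: funext. Qed.

Lemma subst_subst σ τ t : subst σ (subst τ t) = subst (subst σ \o τ) t.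
Proof. by elim: t => //= f ts IH; congr Fun; apply: funext. Qed.

Lemma vars_finite t : finite_set (vars t).
Proof. by elim: t => [x|f ts IH] /=; [exact: finite_set1|exact: bigcup_finite]. Qed.

Lemma vars_subst σ t y :
  vars (subst σ t) y <-> exists2 x, vars t x & vars (σ x) y.
Proof.
elim: t => [x|f ts IH]; first by split=> [yσx|[_ -> //]]; exists x.
rewrite [subst _ _]/= vars_FunP; split=> [[i /IH[x tix yσx]]|[x]].
  by exists x => //; apply/vars_FunP; exists i.
by move=> /vars_FunP[i tix] yσx; exists i; apply/IH; exists x.
Qed.

Fixpoint comp_ctx C D : ctx :=
  if C is CFun f i ts C' then CFun f i ts (comp_ctx C' D) else D.

Fixpoint subst_ctx σ C : ctx :=
  if C is CFun f i ts C' then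
    CFun f i (fun j => subst σ (ts j)) (subst_ctx σ C')
  else Hole.

Lemma fill_comp C D t : fill (comp_ctx C D) t = fill C (fill D t).
Proof.
by elim: C => //= f i ts C IH; congr Fun; apply: funext => j; rewrite IH.
Qed.

Lemma subst_fill σ C t : subst σ (fill C t) = fill (subst_ctx σ C) (subst σ t).
Proof.
elim: C => //= f i ts C IH; congr Fun; apply: funext => j.
by case: eqP; rewrite ?IH.
Qed.

Lemma fill_arg (f : F) (i : 'I_(arity f)) (ts : 'I_(arity f) -> tm) :
  fill (CFun f i ts Hole) (ts i) = Fun f ts.
Proof. by congr Fun; apply: funext => j; case: eqP => [->|]. Qed.

Lemma vars_fill t x : vars t x -> exists C, fill C (Var x) = t.
Proof.
elim: t => [y ->|f ts IH /vars_FunP[i /IH[C eqC]]]; first by exists Hole.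
exists (CFun f i ts C) => /=; congr Fun; apply: funext => j.
by case: eqP => // ->.
Qed.

(** Adding two at each symbol makes variables the only terms of size 1, so that instantiating a
    variable by a constant already increases the size. *)
Fixpoint tsize t : nat :=
  if t is Fun f ts then (\sum_i tsize (ts i)).+2 else 1.

Lemma tsize_gt0 t : 0 < tsize t.
Proof. by case: t. Qed.

Lemma tsize_arg (f : F) (ts : 'I_(arity f) -> tm) i :
  tsize (ts i) < tsize (Fun f ts).
Proof. by rewrite /= (bigD1 i) //= ltnS -addnS leq_addr. Qed.

Lemma tsize_var_subst σ t x : vars t x -> tsize (σ x) <= tsize (subst σ t).
Proof.
elim: t => [y -> //|f ts IH /vars_FunP[i /IH le_i]].
exact: leq_trans le_i (ltnW (tsize_arg (fun i => subst σ (ts i)) i)).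
Qed.

Lemma tsize_subst σ t : tsize t <= tsize (subst σ t).
Proof.
by elim: t => [x|f ts IH] /=; rewrite ?tsize_gt0// !ltnS; apply: leq_sum.
Qed.


(** No argument shrinks under a substitution, so if the sum does not grow then no argument grows,
    down to the variables, whose images must then have size 1. *)
Lemma tsize_subst_var σ t : tsize (subst σ t) <= tsize t ->
  forall x, vars t x -> is_var (σ x).
Proof.
elim: t => [y /= size1 x ->|f ts IH /=].
  by case: (σ y) size1 => // z _; exists z.
rewrite !ltnS => le_sum x.
move=> /vars_FunP[i]; apply: IH; move: le_sum.
rewrite (bigD1 i) //= [leqRHS](bigD1 i) //= => le_sum.
rewrite -(leq_add2r (\sum_(j | j != i) tsize (ts j))).
by apply: leq_trans le_sum; rewrite leq_add2l leq_sum// => j _; apply: tsize_subst.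
Qed.

Lemma tsize_fill C t : tsize t <= tsize (fill C t).
Proof.
elim: C => //= f i ts C IH; rewrite (bigD1 i)//= eqxx.
by rewrite (leq_trans IH)// -!addnS leq_addr.
Qed.

Lemma tsize_fill_hole C t : tsize (fill C t) <= tsize t -> C = Hole.
Proof.
case: C => //= f i ts C; rewrite (bigD1 i)//= eqxx -!addnS addnS => lt_t.
have := leq_trans (leq_ltn_trans (leq_addr _ _) lt_t) (tsize_fill C t).
by rewrite ltnn.
Qed.

(** * Most general unifiers of finite systems *)

Fixpoint unifies σ (L : seq (tm * tm)) : Prop :=
  if L is e :: L' then unifier σ e.1 e.2 /\ unifies σ L' else True.

Lemma unifies_cat σ L1 L2 :
  unifies σ (L1 ++ L2) <-> unifies σ L1 /\ unifies σ L2.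
Proof. by elim: L1 => /= [|e L1 ->]; tauto. Qed.

Lemma unifies_map (I : eqType) (ss ts : I -> tm) σ (r : seq I) :
  unifies σ [seq (ss i, ts i) | i <- r] <->
  forall i, i \in r -> unifier σ (ss i) (ts i).
Proof.
elim: r => //= j r ->; split=> [[uj ur] i|u].
  by rewrite inE => /predU1P[->|/ur].
by split=> [|i ir]; apply: u; rewrite inE ?eqxx// ir orbT.
Qed.

Lemma unifier_Fun (f : F) (ss ts : 'I_(arity f) -> tm) σ :
  unifier σ (Fun f ss) (Fun f ts) <->
  unifies σ [seq (ss i, ts i) | i <- enum 'I_(arity f)].
Proof.
rewrite unifies_map /unifier /=; split=> [/Fun_inj eq_args i _|eq_args].
  exact: (congr1 (fun us => us i) eq_args).
by congr Fun; apply: funext => i; apply: eq_args; rewrite mem_enum.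
Qed.

Lemma unifier_sym σ s t : unifier σ s t -> unifier σ t s.
Proof. exact: esym. Qed.

Definition upd σ (x : V) (t : tm) : V -> tm :=
  fun y => if pselect (y = x) then t else σ y.

Lemma upd_eq σ x t : upd σ x t x = t.
Proof. by rewrite /upd; case: pselect. Qed.

Lemma subst_upd σ x t s : ~ vars s x -> subst (upd σ x t) s = subst σ s.
Proof.
move=> nxs; apply: eq_subst => y ys; rewrite /upd.
by case: pselect => //= yx; rewrite -yx in nxs.
Qed.

Lemma subst_solved σ x t s :
  σ x = subst σ t -> subst σ (subst (upd Var x t) s) = subst σ s.
Proof.
move=> σx; rewrite subst_subst; apply: eq_subst => y _ /=; rewrite /upd.
by case: pselect => //= ->.
Qed.

Lemma unifies_solved σ x t L : σ x = subst σ t ->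
  unifies σ [seq (subst (upd Var x t) e.1, subst (upd Var x t) e.2) | e <- L]
  <-> unifies σ L.
Proof.
by move=> σx; elim: L => //= e L ->; rewrite /unifier !subst_solved.
Qed.

Definition most_general μ (L : seq (tm * tm)) : Prop :=
  unifies μ L /\
  forall τ, unifies τ L -> exists δ, forall x, τ x = subst δ (μ x).

(** Eliminating [x] loses no unifier: any [τ] with [τ x = subst τ t] is unchanged when precomposed
    with the replacement of [x] by [t]. *)
Lemma most_general_solve μ x t L : ~ vars t x ->
  most_general μ
    [seq (subst (upd Var x t) e.1, subst (upd Var x t) e.2) | e <- L] ->
  most_general (subst μ \o upd Var x t) ((Var x, t) :: L).
Proof.
move=> nxt [μL mgμ]; set ν := subst μ \o upd Var x t.
have νE s : subst ν s = subst μ (subst (upd Var x t) s) by rewrite subst_subst.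
have νx : ν x = subst ν t.
  by rewrite νE subst_upd// subst_id /ν/= upd_eq.
split; first split=> //.
  by elim: L μL {mgμ} => //= e L IH [eμ /IH]; rewrite /unifier !νE.
move=> τ [/= τx τL].
have [|δ δμ] := mgμ τ; first exact/unifies_solved.
exists δ => y; rewrite -[τ y]/(subst τ (Var y)) -(subst_solved (Var y) τx) /=.
by rewrite subst_subst; apply: eq_subst => z _; apply: δμ.
Qed.

(** Otherwise [x] lies strictly inside [t], and [τ x] would be smaller than [subst τ t]. *)
Lemma occurs_check τ x t : vars t x -> τ x = subst τ t -> t = Var x.
Proof.
case: t => [y /= ->//|f ts /vars_FunP[i tix] τx]; exfalso.
have := leq_ltn_trans (tsize_var_subst τ tix)
  (tsize_arg (fun i => subst τ (ts i)) i).
by rewrite τx ltnn.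
Qed.

(** Counting left-hand sides is enough, since under a unifier both sides of each pair coincide. *)
Definition weight τ (L : seq (tm * tm)) : nat :=
  sumn [seq tsize (subst τ e.1) | e <- L].

Lemma weight_solved τ x t L : τ x = subst τ t ->
  weight τ [seq (subst (upd Var x t) e.1, subst (upd Var x t) e.2) | e <- L]
  = weight τ L.
Proof.
move=> τx; rewrite /weight -map_comp; congr sumn; apply: eq_map => e /=.
by rewrite subst_solved.
Qed.

(* A known unifier [τ] bounds the recursion: decomposition decreases the weight
   under [τ], and eliminating a solved variable leaves the remaining instances
   under [τ] unchanged. *)
Lemma unifies_most_general τ L : unifies τ L -> exists μ, most_general μ L.
Proof.
have [n] := ubnP (weight τ L); elim: n L => // n IH [|[s t] L] ltLn.
  by exists Var; split=> // σ _; exists σ.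
have solve x u : weight τ L < n -> τ x = subst τ u -> unifies τ L ->
    exists μ, most_general μ ((Var x, u) :: L).
  move=> ltL τx τL; have [xu|nxu] := pselect (vars u x).
    rewrite (occurs_check xu τx); have [μ [μL mgμ]] := IH _ ltL τL.
    by exists μ; split=> // σ [_ /mgμ].
  have [||μ mgμ] :=
      IH [seq (subst (upd Var x u) e.1, subst (upd Var x u) e.2) | e <- L].
  - by rewrite weight_solved.
  - exact/unifies_solved.
  by eexists; apply: most_general_solve nxu mgμ.
move=> [/= τst τL].
have ltL : weight τ L < n.
  move: ltLn; rewrite ltnS; apply: leq_trans.
  by rewrite /weight/= -addn1 addnC leq_add2r tsize_gt0.
case: s t ltLn τst => [x|f ss] [y|g ts] ltLn τst; try exact: solve.
  have [μ [[/= /unifier_sym μyx μL] mgμ]] := solve y (Fun f ss) ltL (esym τst) τL.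
  exists μ; split=> // σ [/unifier_sym σyx σL]; exact: mgμ.
have fg : f = g by case: τst.
subst g; have [||μ [μL mgμ]] := IH ([seq (ss i, ts i) | i <- enum 'I_(arity f)] ++ L).
- move: ltLn; rewrite ltnS; apply: leq_trans.
  rewrite /weight map_cat sumn_cat /= ltn_add2r -map_comp sumnE big_map big_enum /=.
  by [].
- by apply/unifies_cat; split=> //; apply/unifier_Fun.
exists μ; split; first by move/unifies_cat: μL => [/unifier_Fun].
by move=> σ /= [/unifier_Fun σf σL]; apply: mgμ; apply/unifies_cat.
Qed.

Lemma mgu_exists τ s t : unifier τ s t -> exists μ, mgu μ s t.
Proof.
move=> τst; have [//|μ [[μst _] mgμ]] := @unifies_most_general τ [:: (s, t)].
by exists μ; split=> // σ σst; apply: mgμ.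
Qed.

(** * Encompassment and its combination with a reduction order *)

Lemma encompasses_refl t : encompasses t t.
Proof. by exists Hole, Var; rewrite subst_id. Qed.

Lemma encompasses_trans s t u :
  encompasses s t -> encompasses t u -> encompasses s u.
Proof.
move=> [C [σ ->]] [D [τ ->]]; exists (comp_ctx C (subst_ctx σ D)), (subst σ \o τ).
by rewrite fill_comp subst_fill subst_subst.
Qed.

Lemma encompasses_fill C σ t : encompasses (fill C (subst σ t)) t.
Proof. by exists C, σ. Qed.

Lemma encompasses_properly s t u :
  encompasses s t -> properly_encompasses t u -> properly_encompasses s u.
Proof.
move=> st [tu nut]; split; first exact: encompasses_trans tu.
by move=> us; apply: nut; apply: encompasses_trans us st.
Qed.

Lemma properly_encompasses_trans s t u :
  properly_encompasses s t -> encompasses t u -> properly_encompasses s u.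
Proof.
move=> [st nts] tu; split; first exact: encompasses_trans tu.
by move=> us; apply: nts; apply: encompasses_trans tu us.
Qed.


(** [{classic V}] supplies the equality test with which the distinct variables of a term are
    counted. *)
Fixpoint varseq t : seq {classic V} :=
  match t with
  | Var x => [:: x]
  | Fun f ts => flatten [seq varseq (ts i) | i <- enum 'I_(arity f)]
  end.

Lemma mem_varseq t (x : {classic V}) : x \in varseq t <-> vars t x.
Proof.
elim: t => [y|f ts IH]; first by rewrite inE; split=> [/eqP|/= ->].
rewrite vars_FunP; split=> [/flatten_mapP[i _ /IH]|[i /IH xi]]; first by exists i.
by apply/flatten_mapP; exists i; rewrite ?mem_enum.
Qed.

Lemma varseq_rename (ρ : V -> V) t :
  varseq (subst (Var \o ρ) t) = map (ρ : {classic V} -> {classic V}) (varseq t).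
Proof.
elim: t => //= f ts IH; rewrite map_flatten -map_comp; congr flatten.
by apply: eq_map => i /=; apply: IH.
Qed.

Definition nvars t : nat := size (undup (varseq t)).

(** A map on variables can only merge them; if the number of distinct variables does not drop, it is
    injective on those of [t]. *)
Lemma nvars_rename (ρ : V -> V) t :
  nvars (subst (Var \o ρ) t) <= nvars t /\
  (nvars t <= nvars (subst (Var \o ρ) t) ->
   forall x y : {classic V}, vars t x -> vars t y -> ρ x = ρ y -> x = y).
Proof.
rewrite /nvars varseq_rename; set l := varseq t.
pose ρ' : {classic V} -> {classic V} := ρ; rewrite -/ρ'.
have sub : {subset undup (map ρ' l) <= map ρ' (undup l)}.
  move=> y; rewrite mem_undup => /mapP[x xl ->].
  by apply: map_f; rewrite mem_undup.
split; first by rewrite -(size_map ρ' (undup l)) uniq_leq_size// undup_uniq.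
rewrite -(size_map ρ' (undup l)) => le_size.
have uni := leq_size_uniq (undup_uniq _) sub le_size.
move=> x y /mem_varseq xt /mem_varseq yt eqρ.
have {}xt : x \in undup l by rewrite mem_undup.
have {}yt : y \in undup l by rewrite mem_undup.
rewrite -(nth_index x xt) -(nth_index x yt); congr nth.
apply/eqP; rewrite -(nth_uniq (ρ' x) _ _ uni) ?size_map ?index_mem//.
by rewrite !(nth_map x) ?index_mem// !nth_index//; apply/eqP.
Qed.

(** If the sizes agree, the context is empty and the substitution sends variables to variables. Were
    it injective on the variables of [t], it could be inverted and [t] would encompass [s]; so it
    merges two of them. *)
Lemma properly_encompasses_decr s t : properly_encompasses s t ->
  tsize t < tsize s \/ tsize t = tsize s /\ nvars s < nvars t.
Proof.
move=> [[C [σ ->]] nts].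
have le1 := tsize_subst σ t; have le2 := tsize_fill C (subst σ t).
have [lt|ge] := ltnP (tsize t) (tsize (fill C (subst σ t))); first by left.
right; split; first by apply/eqP; rewrite eqn_leq ge (leq_trans le1).
have C0 : C = Hole by apply: tsize_fill_hole (leq_trans ge le1).
rewrite {C}C0 /= in nts ge le2 *.
have σvar := tsize_subst_var ge.
have [ρ ρE] : exists ρ : V -> V, forall x, vars t x -> σ x = Var (ρ x).
  have /choice[ρ ρE] : forall x, exists y, vars t x -> σ x = Var y.
    move=> x; have [xt|nxt] := pselect (vars t x); last by exists x.
    by have [y] := σvar x xt; exists y.
  by exists ρ.
have σρ : subst σ t = subst (Var \o ρ) t by apply: eq_subst.
rewrite σρ in nts *; rewrite ltnNge; apply/negP => /(nvars_rename ρ t).2 injρ.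
apply: nts.
(* The inverse of [ρ] on the variables of [t]; outside the image its value is arbitrary. *)
have /choice[ρ' ρ'E] : forall y, exists x, forall z, vars t z -> ρ z = y -> x = z.
  move=> y; have [[x xt <-]|no] := pselect (exists2 x, vars t x & ρ x = y).
    by exists x => z zt /esym; apply: injρ.
  by exists y => z zt zy; case: no; exists z.
exists Hole, (Var \o ρ'); rewrite /= subst_subst -[LHS]subst_id.
by apply: eq_subst => x xt /=; rewrite (ρ'E _ x).
Qed.

Lemma nvars_le t : nvars t <= tsize t.
Proof.
apply: leq_trans (size_undup _) _; elim: t => //= f ts IH.
apply: leqW; apply: leqW.
rewrite size_flatten /shape -map_comp sumnE big_map big_enum /=.
exact: leq_sum.
Qed.

(** Along a descent the size drops, or it stays and the number of distinct variables grows. The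
    latter is bounded by the size, so size and then [tsize s - nvars s] decrease
    lexicographically. *)
Lemma properly_encompasses_wf :
  well_founded (fun t s => properly_encompasses s t).
Proof.
suff H n m s : tsize s < n -> tsize s - nvars s < m ->
    Acc (fun t s => properly_encompasses s t) s.
  by move=> s; apply: H (ltnSn _) (ltnSn _).
elim: n m s => [m s|n IHn]; first by rewrite ltn0.
elim=> [s|m IHm s lt_n lt_m]; first by rewrite ltn0.
constructor=> t /properly_encompasses_decr[lt|[eq_size lt_vars]].
  apply: (IHn (tsize t - nvars t).+1); last exact: ltnSn.
  exact: leq_trans lt lt_n.
apply: IHm; rewrite eq_size//; rewrite ltnS in lt_m; apply: leq_trans lt_m.
by rewrite ltn_sub2l// -eq_size (leq_trans lt_vars)// nvars_le.
Qed.

Section ReductionOrder.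
Variable gt : relation tm.
Hypothesis gt_reduction : reduction_order gt.
Let gt_wf := gt_wf gt_reduction.
Let gt_trans := gt_trans gt_reduction.
Let gt_irrefl := gt_irrefl gt_reduction.

(** The induction order for runs. Encompassment is built in after [gt], so that the relation absorbs
    encompassment on both sides. *)
Definition gt_enc s t : Prop :=
  (exists2 s', gt s s' & encompasses s' t) \/ properly_encompasses s t.

(** The decrease from [t] to [u] is carried out inside the instance of [t] that occurs in [s]. *)
Lemma enc_gt s t u : encompasses s t -> gt t u ->
  exists2 s', gt s s' & encompasses s' u.
Proof.
move=> [C [σ ->]] tu; exists (fill C (subst σ u)).
  exact/(gt_fill gt_reduction)/(gt_subst gt_reduction).
exact: encompasses_fill.
Qed.

Lemma enc_gt_enc s t u : encompasses s t -> gt_enc t u -> gt_enc s u.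
Proof.
move=> st [[t' tt' t'u]|tu]; last by right; apply: encompasses_properly tu.
have [s' ss' s't'] := enc_gt st tt'; left; exists s' => //.
exact: encompasses_trans t'u.
Qed.

Lemma gt_enc_enc s t u : gt_enc s t -> encompasses t u -> gt_enc s u.
Proof.
move=> [[s' ss' s't]|st] tu; last by right; apply: properly_encompasses_trans tu.
by left; exists s' => //; apply: encompasses_trans tu.
Qed.

(** The outer induction is on [gt] for a term [s], the inner one on proper encompassment for the
    terms [t] that [s] encompasses. By [enc_gt], a decrease of [t] in [gt] lifts to one of [s]. *)
Lemma gt_enc_wf : well_founded (fun t s => gt_enc s t).
Proof.
suff H s : forall t, encompasses s t -> Acc (fun t s => gt_enc s t) t.
  by move=> s; apply: H (encompasses_refl s).
elim/(well_founded_ind gt_wf): s => s IHs t.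
elim/(well_founded_ind properly_encompasses_wf): t => t IHt st.
constructor=> u [[t' tt' t'u]|tu]; last first.
  by apply: IHt => //; case: (encompasses_properly st tu).
have [s' ss' s't'] := enc_gt st tt'.
by apply: IHs ss' _ _; apply: encompasses_trans t'u.
Qed.

(** Iterating the context would give an infinite descent from [s] through [fill C s],
    [fill C (fill C s)] and so on. *)
Lemma gt_fill_irrefl C s : ~ gt s (fill C s).
Proof.
elim/(well_founded_ind gt_wf): s => s IH gt_s.
exact: IH gt_s (gt_fill gt_reduction C gt_s).
Qed.

(** Instantiating by [s] a variable of [t] that is absent from [s] leaves [s] unchanged and puts it
    above a term containing it. *)
Lemma gt_vars s t : gt s t -> vars t `<=` vars s.
Proof.
move=> st x xt; apply: contrapT => nxs; have [C Ct] := vars_fill xt.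
have := gt_subst gt_reduction (upd Var x s) st.
by rewrite subst_upd// subst_id -Ct subst_fill /= upd_eq => /gt_fill_irrefl.
Qed.

Lemma gt_is_TRS (X : set (tm * tm)) :
  (forall l r, X (l, r) -> gt l r) -> is_TRS X.
Proof.
move=> Xgt l r /Xgt lr; split; last exact: gt_vars.
move=> [x lx]; rewrite {l}lx in lr.
have [/vars_fill[C Cr]|nxr] := pselect (vars r x).
  by apply: (@gt_fill_irrefl C (Var x)); rewrite Cr.
(* Here [x] does not occur in [r], so replacing [x] by [r] turns the rule into [r] above [r]. *)
have := gt_subst gt_reduction (upd Var x r) lr.
by rewrite (subst_upd _ _ nxr) subst_id /= upd_eq => /gt_irrefl.
Qed.

End ReductionOrder.

End Terms.

(** * Renaming, positions and conversions *)

Lemma clos_rt_map (T U : Type) (r : relation T) (r' : relation U) (f : T -> U) :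
  (forall x y, r x y -> r' (f x) (f y)) ->
  forall x y, clos_refl_trans T r x y -> clos_refl_trans U r' (f x) (f y).
Proof.
move=> rr' x y; elim=> [a b /rr'|a|a b c _ ab _ bc]; first exact: rt_step.
  exact: rt_refl.
exact: rt_trans ab bc.
Qed.

Lemma clos_rt_sym (T : Type) (r : relation T) :
  (forall x y, r x y -> r y x) ->
  forall x y, clos_refl_trans T r x y -> clos_refl_trans T r y x.
Proof.
move=> symr x y; elim=> [a b /symr|a|a b c _ ba _ cb]; first exact: rt_step.
  exact: rt_refl.
exact: rt_trans cb ba.
Qed.

(** Variants are taken along bijections, so the renaming is composed from transpositions, each
    moving one more variable of [A] out of [B]. *)
Lemma rename_apart (V : Type) (A : seq {classic V}) (B : set V) :
  infinite_set [set: V] -> finite_set B ->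
  exists2 ρ : V -> V, bijective ρ & forall x, x \in A -> ~ B (ρ x).
Proof.
move=> infV finB; elim: A => [|x A [ρ bijρ apart]].
  by exists id => //; exists id.
have [Bρx|nBρx] := pselect (B (ρ x)); last first.
  by exists ρ => // y; rewrite inE => /predU1P[->|/apart].
have [z [nBz nρA]] : exists z : {classic V}, ~ B z /\
    z \notin [seq (ρ y : {classic V}) | y <- A].
  apply: contrapT => no; apply: infV.
  have finU : finite_set (B `|` [set` [seq (ρ y : {classic V}) | y <- A]]).
    by rewrite finite_setU; split=> //; apply: (@finite_seq {classic V}).
  apply: sub_finite_set finU => z _.
  apply: contrapT => nz; apply: no; exists z; split.
    by move=> Bz; apply: nz; left.
  by apply/negP => zA; apply: nz; right.
(* Since [z] is not an image of [A], no variable already moved out of [B] is sent back to [ρ x]. *)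
pose swap y := if pselect (y = ρ x) then z else if pselect (y = z) then ρ x else y.
have swapK : involutive swap.
  move=> y; rewrite /swap.
  by do 5?case: pselect => //=; congruence.
exists (swap \o ρ); first exact: bij_comp (Bijective swapK swapK) bijρ.
move=> y; rewrite inE /= /swap => /predU1P[->|yA].
  by case: pselect.
case: pselect => [ρyx|nρyx] //=; case: pselect => [ρyz|_] /=.
  move/negP: nρA => []; rewrite -ρyz.
  exact: (map_f (ρ : {classic V} -> {classic V})).
exact: apart.
Qed.

Section Positions.
Context {F : signature} {V : Type}.
Local Notation tm := (term F V).
Local Notation ctx := (context F V).
Implicit Types (s t u : tm) (C D : ctx) (σ τ : V -> tm).

Fixpoint hole_pos C : seq nat :=
  if C is CFun f i ts C' then val i :: hole_pos C' else [::].

Lemma replace_at_fill C t u : replace_at (fill C t) (hole_pos C) u = fill C u.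
Proof.
elim: C => //= f i ts C IH; congr Fun; apply: funext => j.
by rewrite (inj_eq val_inj); case: eqP => // _; rewrite IH.
Qed.

Lemma subterm_at_Fun (f : F) (ts : 'I_(arity f) -> tm) k q u :
  subterm_at (Fun f ts) (k :: q) = Some u ->
  exists2 i, val i = k & subterm_at (ts i) q = Some u.
Proof. by rewrite /=; case: insubP => // i _ <- sub; exists i. Qed.

Lemma subterm_at_filled t p u : subterm_at t p = Some u ->
  exists2 C, fill C u = t & hole_pos C = p.
Proof.
elim: p t => [|k q IH] [x|f ts] //; try by case=> ->; exists Hole.
move=> /subterm_at_Fun[i ik /IH[C Cu Cq]]; exists (CFun f i ts C).
  by rewrite /= -[RHS](fill_arg i); congr Fun; rewrite Cu.
by rewrite /= Cq ik.
Qed.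

Lemma vars_subterm_at t p u : subterm_at t p = Some u -> vars u `<=` vars t.
Proof.
elim: p t => [|k q IH] [x|f ts] //; try by case=> ->.
by move=> /subterm_at_Fun[i _ /IH ui] x /ui xi; exists i.
Qed.

Lemma subterm_at_subst σ t p u :
  subterm_at t p = Some u -> subterm_at (subst σ t) p = Some (subst σ u).
Proof.
elim: p t => [|k q IH] [x|f ts] //; try by case=> ->.
by move=> /subterm_at_Fun[i <- /IH /=]; rewrite valK.
Qed.

Lemma subst_replace_at σ t p u v : subterm_at t p = Some u ->
  subst σ (replace_at t p v) = replace_at (subst σ t) p (subst σ v).
Proof.
elim: p t => [|k q IH] [x|f ts] //.
move=> /subterm_at_Fun[i <- /IH eqi] /=; congr Fun; apply: funext => j.
by rewrite (inj_eq val_inj); case: eqP => // ->.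
Qed.

Lemma proper_subterm_filled t u : proper_subterm u t ->
  exists2 C, C <> Hole & t = fill C u.
Proof.
move=> [p [p0 /subterm_at_filled[C Cu Cp]]]; exists C => // C0.
by rewrite C0 in Cp; rewrite -Cp in p0.
Qed.

Lemma proper_subterm_subst σ t u :
  proper_subterm u t -> proper_subterm (subst σ u) (subst σ t).
Proof. by move=> [p [p0 /(subterm_at_subst σ) pu]]; exists p. Qed.

Lemma tsize_proper_subterm t u : proper_subterm u t -> tsize u < tsize t.
Proof.
move=> /proper_subterm_filled[C C0 ->]; rewrite ltnNge; apply/negP.
by move=> /tsize_fill_hole.
Qed.

End Positions.

Section Conversions.
Context {F : signature} {V : Type}.
Local Notation tm := (term F V).
Implicit Types (X : set (tm * tm)) (P Q : tm -> Prop) (s t u : tm)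
  (σ τ : V -> tm).

Lemma rstep_rule X l r : X (l, r) -> rstep X l r.
Proof. by move=> Xlr; exists l, r, Hole, Var; rewrite !subst_id. Qed.

Lemma rstep_fill X C s t : rstep X s t -> rstep X (fill C s) (fill C t).
Proof.
move=> [l [r [D [σ [Xlr -> ->]]]]]; exists l, r, (comp_ctx C D), σ.
by rewrite !fill_comp.
Qed.

Lemma rstep_subst X σ s t : rstep X s t -> rstep X (subst σ s) (subst σ t).
Proof.
move=> [l [r [C [τ [Xlr -> ->]]]]].
exists l, r, (subst_ctx σ C), (subst σ \o τ).
by rewrite !subst_fill !subst_subst.
Qed.

Lemma sstep_sym X s t : sstep X s t -> sstep X t s.
Proof. by case; [right|left]. Qed.

Lemma sstep_fill X C s t : sstep X s t -> sstep X (fill C s) (fill C t).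
Proof. by case=> /(rstep_fill C); [left|right]. Qed.

Lemma sstep_subst X σ s t : sstep X s t -> sstep X (subst σ s) (subst σ t).
Proof. by case=> /(rstep_subst σ); [left|right]. Qed.

Lemma rsteps_fill X C s t : rsteps X s t -> rsteps X (fill C s) (fill C t).
Proof. by apply: clos_rt_map => x y; apply: rstep_fill. Qed.

Lemma rsteps_args X (f : F) (ss ts : 'I_(arity f) -> tm) :
  (forall i, rsteps X (ss i) (ts i)) -> rsteps X (Fun f ss) (Fun f ts).
Proof.
move=> st.
(* The arguments are rewritten from left to right; in [mix k] the first [k] are done. *)
pose mix k := Fun f (fun i : 'I_(arity f) => if i < k then ts i else ss i).
have mixS k : k < arity f -> rsteps X (mix k) (mix k.+1).
  move=> ltk; pose i := Ordinal ltk.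
  have := rsteps_fill (CFun f i (fun j => if j < k then ts j else ss j) Hole) (st i).
  rewrite /=; congr rsteps; congr Fun; apply: funext => j.
    by case: eqP => [->|//]; rewrite ltnn.
  case: eqP => [->|/eqP ji]; first by rewrite leqnn.
  have /negPf jk : val j != k by rewrite -[k]/(val i) (inj_eq val_inj).
  by rewrite [(j < k.+1)%N]ltnS [(j <= k)%N]leq_eqVlt jk.
have {mixS} mixP k : k <= arity f -> rsteps X (mix 0) (mix k).
  elim: k => [_|k IH ltk]; first exact: rt_refl.
  by apply: rt_trans (mixS k ltk); apply/IH/ltnW.
have := mixP _ (leqnn _); rewrite /mix; congr rsteps; congr Fun.
by apply: funext => i; rewrite ltn_ord.
Qed.

Lemma rsteps_substs X σ τ t :
  (forall x, rsteps X (σ x) (τ x)) -> rsteps X (subst σ t) (subst τ t).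
Proof. by move=> στ; elim: t => //= f ts IH; apply: rsteps_args. Qed.

Lemma conversion_sym X s t : conversion X s t -> conversion X t s.
Proof. by apply: clos_rt_sym => x y; apply: sstep_sym. Qed.

Lemma conversion_fill X C s t :
  conversion X s t -> conversion X (fill C s) (fill C t).
Proof. by apply: clos_rt_map => x y; apply: sstep_fill. Qed.

Lemma conversion_subst X σ s t :
  conversion X s t -> conversion X (subst σ s) (subst σ t).
Proof. by apply: clos_rt_map => x y; apply: sstep_subst. Qed.

Lemma conversion_sub X Y :
  (forall l r, X (l, r) -> conversion Y l r) ->
  forall s t, conversion X s t -> conversion Y s t.
Proof.
move=> XY s t; elim=> [a b ab|a|a b c _ ab _ bc]; last 2 first.
- exact: rt_refl.
- exact: rt_trans ab bc.
suff H u v : rstep X u v -> conversion Y u v.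
  by case: ab => /H // /conversion_sym.
move=> [l [r [C [σ [/XY lr -> ->]]]]].
exact/conversion_fill/conversion_subst.
Qed.

(** [P] constrains the two ends of each step only, so every term is related to itself by the empty
    conversion, even outside [P]. *)
Definition conversion_in X P : relation tm :=
  clos_refl_trans tm (fun s t => [/\ sstep X s t, P s & P t]).

Lemma conversion_in_sym X P s t : conversion_in X P s t -> conversion_in X P t s.
Proof. by apply: clos_rt_sym => x y [/sstep_sym]. Qed.

Lemma conversion_in_map X P Q (h : tm -> tm) :
  (forall s t, sstep X s t -> sstep X (h s) (h t)) ->
  (forall s, P s -> Q (h s)) ->
  forall s t, conversion_in X P s t -> conversion_in X Q (h s) (h t).
Proof.
move=> hstep hP s t; apply: clos_rt_map => x y [xy Px Py].
by split; [exact: hstep|exact: hP|exact: hP].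
Qed.

Lemma conversion_in_sub X P Q : (forall s, P s -> Q s) ->
  forall s t, conversion_in X P s t -> conversion_in X Q s t.
Proof. by move=> PQ s t; apply: (conversion_in_map (h := id)). Qed.

Lemma conversion_inW X P s t : conversion_in X P s t -> conversion X s t.
Proof. by apply: (clos_rt_map (f := id)) => x y []. Qed.

End Conversions.

(** * Confluence from connected prime critical pairs *)

Section Connectedness.
Context {F : signature} {V : Type}.
Local Notation tm := (term F V).
Local Notation ctx := (context F V).
Variables (gt : relation tm) (gt_reduction : reduction_order gt).
Variables (X : set (tm * tm)) (X_gt : forall l r, X (l, r) -> gt l r).
Implicit Types (P : tm -> Prop) (s t u w : tm) (C D : ctx) (σ τ : V -> tm).

Let gt_trans := gt_trans gt_reduction.

Definition down_closed P : Prop := forall s t, P s -> gt s t -> P t.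

Definition bounded s t : tm -> Prop :=
  fun u => [\/ u = s, u = t, gt s u | gt t u].

Definition connected s t : Prop := conversion_in X (bounded s t) s t.

Lemma rstep_gt s t : rstep X s t -> gt s t.
Proof.
move=> [l [r [C [σ [/X_gt lr -> ->]]]]].
exact/(gt_fill gt_reduction)/(gt_subst gt_reduction).
Qed.

Lemma rsteps_down P s t : down_closed P -> rsteps X s t -> P s ->
  P t /\ conversion_in X P s t.
Proof.
move=> dP; elim=> [a b ab Pa|a Pa|a b c _ ab _ bc /ab[/bc[Pc ?] ?]].
- have Pb : P b := dP _ _ Pa (rstep_gt ab).
  by split=> //; apply: rt_step; split=> //; left.
- by split=> //; apply: rt_refl.
- by split=> //; apply: rt_trans; eassumption.
Qed.

Lemma gt_down_closed w : down_closed (gt w).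
Proof. by move=> s t; apply: gt_trans. Qed.

Lemma bounded_sub P s t u :
  down_closed P -> P s -> P t -> bounded s t u -> P u.
Proof. by move=> dP Ps Pt [->|->|/(dP s)|/(dP t)] //; apply. Qed.

Lemma bounded_down_closed s t : down_closed (bounded s t).
Proof.
move=> u v [->|->|su|tu] uv.
- by apply: Or43.
- by apply: Or44.
- by apply: Or43; apply: gt_trans su uv.
- by apply: Or44; apply: gt_trans tu uv.
Qed.

Lemma connected_in P s t :
  down_closed P -> P s -> P t -> connected s t -> conversion_in X P s t.
Proof.
by move=> dP Ps Pt; apply: conversion_in_sub => u; apply: bounded_sub dP Ps Pt.
Qed.

Lemma joinable_in P s t :
  down_closed P -> P s -> P t -> joinable X s t -> conversion_in X P s t.
Proof.
move=> dP Ps Pt [u [su tu]].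
have [_ csu] := rsteps_down dP su Ps; have [_ ctu] := rsteps_down dP tu Pt.
exact: rt_trans csu (conversion_in_sym ctu).
Qed.

Lemma bounded_l s t : bounded s t s. Proof. exact: Or41. Qed.
Lemma bounded_r s t : bounded s t t. Proof. exact: Or42. Qed.

Lemma joinable_connected s t : joinable X s t -> connected s t.
Proof.
apply: joinable_in; [exact: bounded_down_closed|exact: bounded_l|exact: bounded_r].
Qed.

Lemma rstep_connected s t : rstep X s t -> connected s t.
Proof.
move=> st; apply: joinable_connected; exists t; split; first exact: rt_step.
exact: rt_refl.
Qed.

Lemma connected_refl s : connected s s.
Proof. exact: rt_refl. Qed.

Lemma connected_sym s t : connected s t -> connected t s.
Proof.
move=> /conversion_in_sym; apply: conversion_in_sub => u.
by case; [exact: Or42|exact: Or41|exact: Or44|exact: Or43].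
Qed.

Lemma connected_subst σ s t : connected s t -> connected (subst σ s) (subst σ t).
Proof.
apply: conversion_in_map => [u v|u]; first exact: sstep_subst.
case=> [->|->|/(gt_subst gt_reduction σ)|/(gt_subst gt_reduction σ)].
- exact: Or41.
- exact: Or42.
- exact: Or43.
- exact: Or44.
Qed.

Lemma connected_fill C s t : connected s t -> connected (fill C s) (fill C t).
Proof.
apply: conversion_in_map => [u v|u]; first exact: sstep_fill.
case=> [->|->|/(gt_fill gt_reduction C)|/(gt_fill gt_reduction C)].
- exact: Or41.
- exact: Or42.
- exact: Or43.
- exact: Or44.
Qed.

Lemma sstep_connected Y s t : (forall l r, Y (l, r) -> connected l r) ->
  sstep Y s t -> connected s t.
Proof.
move=> Yconn; suff H u v : rstep Y u v -> connected u v.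
  by case=> /H // /connected_sym.
move=> [l [r [C [σ [/Yconn lr -> ->]]]]].
exact/connected_fill/connected_subst.
Qed.

(** Connectedness is composed here through a middle term below one of the ends, which keeps both
    conversions within the bounds [s] and [t]. *)
Lemma connected_step s s' t :
  gt s s' -> connected s s' -> connected s' t -> connected s t.
Proof.
move=> gt_s ss' s't; have dP := @bounded_down_closed s t.
have [Ps Ps' Pt] : [/\ bounded s t s, bounded s t s' & bounded s t t].
  by split; [exact: Or41|exact: Or43|exact: Or42].
exact: rt_trans (connected_in dP Ps Ps' ss') (connected_in dP Ps' Pt s't).
Qed.

(* Newman's lemma with joinability of local peaks weakened to conversion below
   the peak. *)
Lemma connected_confluent :
  (forall w t u, rstep X w t -> rstep X w u -> conversion_in X (gt w) t u) ->
  confluent X.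
Proof.
move=> peak w; elim/(well_founded_ind (gt_wf gt_reduction)): w => w IH t u wt wu.
(* The induction hypothesis applies at every intermediate term, since all of them are below [w]; it
   merges the joins of consecutive pieces. *)
have join_in v v' : conversion_in X (gt w) v v' -> gt w v -> joinable X v v'.
  elim=> [a b [[ab|ba] _ _] _|a _|a b c ab join_ab bc join_bc wa].
  - by exists b; split; [exact: rt_step|exact: rt_refl].
  - by exists a; split; [exact: rt_refl|exact: rt_step].
  - by exists a; split; apply: rt_refl.
  have wb : gt w b.
    by elim: ab wa {join_ab join_bc bc} => [? ? []|//|? ? ? _ h1 _ h2 /h1 /h2].
  have [d [ad bd]] := join_ab wa; have [e [be ce]] := join_bc wb.
  have [f [df ef]] := IH b wb d e bd be.
  by exists f; split; [apply: rt_trans ad df|apply: rt_trans ce ef].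
have first_step v : rsteps X w v ->
    v = w \/ exists2 w', rstep X w w' & rsteps X w' v.
  move=> wv; have {}wv := clos_rt_rt1n _ _ _ _ wv.
  case: v / wv => [|w' v ww' w'v]; first by left.
  by right; exists w' => //; apply: clos_rt1n_rt.
have [->|[t' wt' t't]] := first_step t wt; first by exists u; split=> //; apply: rt_refl.
have [->|[u' wu' u'u]] := first_step u wu.
  by exists t; split=> //; exact: rt_refl.
have gt_t' := rstep_gt wt'; have gt_u' := rstep_gt wu'.
have [v [t'v u'v]] := join_in _ _ (peak _ _ _ wt' wu') gt_t'.
have [a [ta va]] := IH t' gt_t' t v t't t'v.
have [b [ub ab]] := IH u' gt_u' u a u'u (rt_trans _ _ _ _ _ u'v va).
by exists b; split=> //; apply: rt_trans ta ab.
Qed.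

(* In the second case [a] lies inside the value of [x], and the step is repeated
   at all occurrences of [x] in [l]. *)
Lemma fill_subst_cases C a l σ : fill C a = subst σ l ->
  (exists u, [/\ subterm_at l (hole_pos C) = Some u, ~ is_var u & subst σ u = a])
  \/ exists x D, σ x = fill D a /\ forall b, rstep X a b ->
       rsteps X (fill C b) (subst (upd σ x (fill D b)) l).
Proof.
elim: C l => [|f i ts C IH] [y|g us] eq_l.
- right; exists y, Hole; split=> // b _; rewrite /= upd_eq; exact: rt_refl.
- by left; exists (Fun g us); split=> // -[y].
- right; exists y, (CFun f i ts C); split=> // b _.
  by rewrite [subst _ (Var _)]/= upd_eq; apply: rt_refl.
have fg : f = g by case: eq_l.
subst g; move/Fun_inj: eq_l => eq_args.
have eq_j j : (if j == i then fill C a else ts j) = subst σ (us j).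
  exact: (congr1 (fun vs => vs j) eq_args).
have := eq_j i; rewrite eqxx => /IH[[u [usub nvar ua]]|[x [D [xD steps]]]].
  by left; exists u; rewrite /= valK.
right; exists x, D; split=> // b ab; apply: rsteps_args => j.
case: eqP => [->|/eqP/negPf ji]; first exact: steps.
have := eq_j j; rewrite ji => ->; apply: rsteps_substs => y.
rewrite /upd; case: pselect => //= [->|_]; last exact: rt_refl.
by rewrite xD; apply/rsteps_fill/rt_step.
Qed.

(** Rules of [X] decrease, so no instance of a reversed rule does: a step of [ordered gt X] is a
    step of [X]. *)
Lemma normal_form_ordered t : normal_form X t -> normal_form (ordered gt X) t.
Proof.
move=> nf [u [l [r [C [σ [[l' [r' [τ [lr gt_lr [-> ->]]]]] tE uE]]]]]].
case: lr => [Xlr|/= /X_gt gt_rl]; last first.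
  apply: (gt_irrefl gt_reduction); apply: gt_trans gt_lr _.
  exact: gt_subst gt_reduction _ _ _ gt_rl.
apply: nf; exists u; rewrite tE uE.
by apply/rstep_fill/rstep_subst/rstep_subst/rstep_rule.
Qed.

(** A reducible proper subterm of the redex is smaller than [t], so the search moves into it. *)
Lemma innermost_redex t u : rstep X t u -> exists C l r σ,
  [/\ X (l, r), t = fill C (subst σ l) &
      forall v, proper_subterm v (subst σ l) -> normal_form X v].
Proof.
have [n] := ubnP (tsize t); elim: n t u => [t u|n IH t u lt_t]; first by rewrite ltn0.
move=> [l [r [C [σ [Xlr tE _]]]]].
have [inner|] := pselect (forall v, proper_subterm v (subst σ l) -> normal_form X v).
  by exists C, l, r, σ.
move=> /existsNP[v /not_implyP[lv /contrapT[v' vv']]].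
have lt_v : tsize v < n.
  apply: leq_trans (tsize_proper_subterm lv) _; rewrite ltnS in lt_t.
  by apply: leq_trans lt_t; rewrite tE tsize_fill.
have [D [l' [r' [τ [Xlr' vE inner]]]]] := IH v v' lt_v vv'.
have [C' _ lE] := proper_subterm_filled lv.
exists (comp_ctx C (comp_ctx C' D)), l', r', τ; split=> //.
by rewrite !fill_comp -vE -lE.
Qed.

(** * Critical peaks *)

Hypothesis V_infinite : infinite_set [set: V].
Hypothesis PCP_connected : forall s t, PCP gt X (s, t) -> connected s t.

Lemma variant_refl (e : tm * tm) : variant e e.
Proof.
exists id; split; first by exists id.
by rewrite (_ : Var \o id = Var)// !subst_id; case: e.
Qed.

(** After renaming the first rule apart, both matching substitutions merge into one unifier [τ],
    which factors through an mgu [μ] as [δ] after [μ]. The peak is then the [δ]-instance of a prime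
    critical pair, and connectedness is closed under substitution. *)
Lemma overlap_connected C l1 r1 σ1 l2 r2 σ2 u :
  X (l1, r1) -> X (l2, r2) -> fill C (subst σ1 l1) = subst σ2 l2 ->
  subterm_at l2 (hole_pos C) = Some u -> ~ is_var u ->
  subst σ2 u = subst σ1 l1 ->
  (forall v, proper_subterm v (subst σ1 l1) -> normal_form X v) ->
  connected (fill C (subst σ1 r1)) (subst σ2 r2).
Proof.
move=> X1 X2 eq_l2 sub_u nvar_u eq_u nf.
have fin2 : finite_set (vars l2 `|` vars r2).
  by rewrite finite_setU; split; apply: vars_finite.
have [ρ bijρ apart] := rename_apart (varseq l1 ++ varseq r1) V_infinite fin2.
have [ρ' ρK _] := bijρ.
(* [τ] acts as [σ2] on the second rule and as [σ1], after undoing the renaming, on the first. *)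
pose τ x := if pselect ((vars l2 `|` vars r2) x) then σ2 x else σ1 (ρ' x).
have τ2 t : vars t `<=` vars l2 `|` vars r2 -> subst τ t = subst σ2 t.
  by move=> sub; apply: eq_subst => x /sub xt; rewrite /τ; case: pselect.
have τ1 t : {subset varseq t <= varseq l1 ++ varseq r1} ->
    subst τ (subst (Var \o ρ) t) = subst σ1 t.
  move=> sub; rewrite subst_subst; apply: eq_subst => x /mem_varseq /sub /apart nx.
  by rewrite /= /τ; case: pselect => //= _; rewrite ρK.
have τl1 : subst τ (subst (Var \o ρ) l1) = subst σ1 l1.
  by apply: τ1 => x xl; rewrite mem_cat xl.
have τr1 : subst τ (subst (Var \o ρ) r1) = subst σ1 r1.
  by apply: τ1 => x xr; rewrite mem_cat xr orbT.
have τl2 : subst τ l2 = subst σ2 l2 by apply: τ2; apply: subsetUl.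
have τr2 : subst τ r2 = subst σ2 r2 by apply: τ2; apply: subsetUr.
have τu : unifier τ (subst (Var \o ρ) l1) u.
  rewrite /unifier τl1 -eq_u τ2// => x /(vars_subterm_at sub_u).
  by left.
have [μ mguμ] := mgu_exists τu; have [δ τδ] := mguμ.2 τ τu.
have δμ t : subst δ (subst μ t) = subst τ t.
  by rewrite subst_subst; apply: eq_subst => x _; rewrite τδ.
have gt_irr l r : X (l, r) -> ~ gt (subst μ r) (subst μ l).
  move=> /X_gt /(gt_subst gt_reduction μ) lr rl.
  exact: (gt_irrefl gt_reduction) (gt_trans lr rl).
have -> : fill C (subst σ1 r1) =
    subst τ (replace_at l2 (hole_pos C) (subst (Var \o ρ) r1)).
  by rewrite (subst_replace_at _ _ sub_u) τl2 τr1 -eq_l2 replace_at_fill.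
rewrite -τr2 -!δμ; apply/connected_subst/PCP_connected.
exists (subst (Var \o ρ) l1), (subst (Var \o ρ) r1), (hole_pos C), l2, r2, μ.
split=> //; first split.
- by exists (l1, r1); [left|exists ρ].
- by exists (l2, r2); [left|apply: variant_refl].
- apply/seteqP; split=> // x [/= x1 x2].
  have [y yA xy] : exists2 y : {classic V},
      y \in varseq l1 ++ varseq r1 & x = ρ y.
    case: x1 => /vars_subst[y yt /= ->]; exists y => //; rewrite mem_cat.
      by apply/orP; left; apply/mem_varseq.
    by apply/orP; right; apply/mem_varseq.
  by apply: (apart y yA); rewrite -xy.
- by exists u.
(* The renamed first rule need not be in [X], so it is instantiated by [δ] and compared with the
   [σ1]-instance of the original. *)
- split; last exact: gt_irr.
  move=> gt_rl; have := gt_subst gt_reduction δ gt_rl.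
  rewrite !δμ τl1 τr1; move: (X_gt X1) => /(gt_subst gt_reduction σ1) lr rl.
  exact: (gt_irrefl gt_reduction) (gt_trans lr rl).
(* Primality descends to the more general term: a step from [v] would give one from its
   [δ]-instance, a proper subterm of the irreducible kind. *)
- move=> v /(proper_subterm_subst δ); rewrite δμ τl1 => /nf nfv.
  apply: normal_form_ordered => -[v' vv']; apply: nfv.
  by exists (subst δ v'); apply: rstep_subst.
Qed.

(** Either the redexes overlap at a non-variable position, or the inner one lies in the value of a
    variable [x] of [l2]. In the latter case the peak is joined by performing the inner step in all
    copies of the value of [x]. *)
Lemma prime_peak C l1 r1 σ1 l2 r2 σ2 :
  X (l1, r1) -> X (l2, r2) -> fill C (subst σ1 l1) = subst σ2 l2 ->
  (forall v, proper_subterm v (subst σ1 l1) -> normal_form X v) ->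
  connected (fill C (subst σ1 r1)) (subst σ2 r2).
Proof.
move=> X1 X2 eq_l2 nf.
have step1 : rstep X (subst σ1 l1) (subst σ1 r1).
  exact/rstep_subst/rstep_rule.
have [[u [sub_u nvar eq_u]]|[x [D [xD steps]]]] := fill_subst_cases eq_l2.
  exact: overlap_connected sub_u nvar eq_u nf.
set τ := upd σ2 x (fill D (subst σ1 r1)).
apply: joinable_connected; exists (subst τ r2); split.
  apply: rt_trans (steps _ step1) (rt_step _ _ _ _ _).
  exact/rstep_subst/rstep_rule.
apply: rsteps_substs => y; rewrite /τ /upd.
case: pselect => //= [->|_]; last exact: rt_refl.
by rewrite xD; apply/rt_step/rstep_fill.
Qed.

(* An innermost redex below the inner redex gives two prime peaks. *)
Lemma root_peak C l1 r1 σ1 l2 r2 σ2 :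
  X (l1, r1) -> X (l2, r2) -> fill C (subst σ1 l1) = subst σ2 l2 ->
  conversion_in X (gt (subst σ2 l2)) (fill C (subst σ1 r1)) (subst σ2 r2).
Proof.
move=> X1 X2 eq_l2.
have step l r σ : X (l, r) -> rstep X (subst σ l) (subst σ r).
  by move=> lr; apply/rstep_subst/rstep_rule.
have [D [l3 [r3 [σ3 [X3 l1E nf]]]]] := innermost_redex (step _ _ σ1 X1).
have peak1 := prime_peak X3 X1 (esym l1E) nf.
have eq_l2' : fill (comp_ctx C D) (subst σ3 l3) = subst σ2 l2.
  by rewrite fill_comp -l1E.
have peak2 := prime_peak X3 X2 eq_l2' nf; rewrite fill_comp in peak2.
have dP := @gt_down_closed (subst σ2 l2).
have gt1 : gt (subst σ2 l2) (fill C (subst σ1 r1)).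
  by rewrite -eq_l2; apply/rstep_gt/rstep_fill/step.
have gt2 : gt (subst σ2 l2) (subst σ2 r2) by apply/rstep_gt/step.
have gt3 : gt (subst σ2 l2) (fill C (fill D (subst σ3 r3))).
  by rewrite -eq_l2 l1E; apply/rstep_gt/rstep_fill/rstep_fill/step.
apply: rt_trans (connected_in dP gt3 gt2 peak2).
exact: connected_in dP gt1 gt3 (connected_fill C (connected_sym peak1)).
Qed.

Lemma local_peak w t u :
  rstep X w t -> rstep X w u -> conversion_in X (gt w) t u.
Proof.
move=> [l1 [r1 [C1 [σ1 [X1 wE ->]]]]] [l2 [r2 [C2 [σ2 [X2 + ->]]]]].
(* The common prefix of the two contexts is peeled off until one redex is at the root or the redexes
   are parallel. *)
elim: C1 w C2 wE => [|f i ts C1 IH] w C2 /= ->.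
  by move=> eq_w; apply/conversion_in_sym/(root_peak X2 X1)/esym.
case: C2 => [|g j us C2] eq_w.
  rewrite /= in eq_w; rewrite [X in gt X]eq_w.
  exact: (root_peak (C := CFun f i ts C1)) X1 X2 eq_w.
have fg : f = g by case: eq_w.
subst g; move/Fun_inj: (eq_w) => eq_args.
have eq_k k := congr1 (fun vs => vs k) eq_args; rewrite /= in eq_k.
have [ij|ij] := eqVneq i j.
  subst j; have := eq_k i; rewrite eqxx => eq_i.
  have peak := IH _ C2 erefl eq_i; pose D := CFun f i ts Hole.
  have := conversion_in_map (h := fill D) (@sstep_fill _ _ X D)
    (@gt_fill _ _ _ gt_reduction D _) peak.
  congr conversion_in; congr Fun; apply: funext => k.
  by case: eqP (eq_k k).
(* Parallel redexes: [ts'] and [us'] are the arguments after the first and the second step, and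
   performing the other step on each gives the same term. *)
pose ts' k := if k == i then fill C1 (subst σ1 r1) else ts k.
pose us' k := if k == j then fill C2 (subst σ2 r2) else us k.
have ji : (j == i) = false by apply/negbTE; rewrite eq_sym.
have tE : Fun f ts' = fill (CFun f j ts' C2) (subst σ2 l2).
  congr Fun; apply: funext => k; case: eqP => // ->.
  by have := eq_k j; rewrite /ts' eqxx ji.
have uE : Fun f us' = fill (CFun f i us' C1) (subst σ1 l1).
  congr Fun; apply: funext => k; case: eqP => // ->.
  by have := eq_k i; rewrite /us' eqxx (negbTE ij).
have vE : fill (CFun f j ts' C2) (subst σ2 r2) = fill (CFun f i us' C1) (subst σ1 r1).
  congr Fun; apply: funext => k; rewrite /ts' /us'.
  case: (eqVneq k j) (eq_k k) => [->|_]; first by rewrite ji.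
  by case: eqP.
have step l r C σ : X (l, r) -> rstep X (fill C (subst σ l)) (fill C (subst σ r)).
  by move=> lr; apply/rstep_fill/rstep_subst/rstep_rule.
apply: joinable_in.
- exact: gt_down_closed.
- exact/rstep_gt/(step _ _ (CFun f i ts C1))/X1.
- by rewrite [X in gt X]eq_w; apply/rstep_gt/(step _ _ (CFun f j us C2))/X2.
- exists (fill (CFun f j ts' C2) (subst σ2 r2)); split; apply: rt_step.
    by have := step _ _ (CFun f j ts' C2) σ2 X2; rewrite -tE.
  by have := step _ _ (CFun f i us' C1) σ1 X1; rewrite -uE -vE.
Qed.

Lemma PCP_confluent : confluent X.
Proof. exact: connected_confluent local_peak. Qed.

End Connectedness.

(** * Runs of ordered completion *)

Lemma persistent_removed (F : signature) (V : Type)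
    (Y : nat -> set (term F V * term F V)) i e :
  Y i e -> ~ persistent Y e -> exists2 k, Y k e & ~ Y k.+1 e.
Proof.
move=> Yi npers; apply: contrapT => no; apply: npers; exists i => //.
move=> j /= /subnK <-; elim: (j - i) => // k IH; rewrite addSn.
by apply: contrapT => nYk; apply: no; exists (k + i).
Qed.

Section Inference.
Context {F : signature} {V : Type}.
Local Notation tm := (term F V).
Local Notation pairs := (set (tm * tm)).
Variables (gt : relation tm) (gt_reduction : reduction_order gt).
Implicit Types (E R Y : pairs) (s t u l r : tm).

Lemma rstep_conversion Y Z s t : (forall l r, Y (l, r) -> conversion Z l r) ->
  rstep Y s t -> conversion Z s t.
Proof. by move=> YZ st; apply: (conversion_sub YZ); apply: rt_step; left. Qed.

Lemma rstep_sub Y Z s t : Y `<=` Z -> rstep Y s t -> rstep Z s t.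
Proof.
by move=> YZ [l [r [C [σ [/YZ lr -> ->]]]]]; exists l, r, C, σ.
Qed.

Lemma pe_step_rstep R s t : pe_step R s t -> rstep R s t.
Proof. by move=> [l [r [C [σ [? ? ? _]]]]]; exists l, r, C, σ. Qed.

Lemma pe_ostep_rstep E s t : pe_ostep gt E s t -> rstep (sym E) s t.
Proof. by move=> [l [r [C [σ [? ? ? _ _]]]]]; exists l, r, C, σ. Qed.

Lemma pe_step_sub R R' s t : R `<=` R' -> pe_step R s t -> pe_step R' s t.
Proof.
by move=> sub [l [r [C [σ [/sub lr ? ? ?]]]]]; exists l, r, C, σ.
Qed.

Lemma sym_sub E E' : E `<=` E' -> sym E `<=` sym E'.
Proof. by move=> sub e [/sub|/sub]; [left|right]. Qed.

Lemma pe_ostep_sub E E' s t :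
  E `<=` E' -> pe_ostep gt E s t -> pe_ostep gt E' s t.
Proof.
move=> /sym_sub sub [l [r [C [σ [/sub lr ? ? ? ?]]]]].
by exists l, r, C, σ.
Qed.

Lemma ordered_gt E l r : ordered gt E (l, r) -> gt l r.
Proof. by move=> [l' [r' [σ [_ lr [-> ->]]]]]. Qed.

Lemma sym_conversion E Z l r :
  E `<=` Z -> sym E (l, r) -> conversion Z l r.
Proof.
move=> sub [/sub Zlr|/= /sub Zrl]; apply: rt_step.
  by left; apply: rstep_rule.
by right; apply: rstep_rule.
Qed.

Lemma sub_conversion Y Z l r : Y `<=` Z -> Y (l, r) -> conversion Z l r.
Proof. by move=> sub /sub Zlr; apply: rt_step; left; apply: rstep_rule. Qed.

Lemma ordered_conversion E Z l r :
  E `<=` Z -> ordered gt E (l, r) -> conversion Z l r.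
Proof.
move=> sub [l' [r' [σ [lr _ [-> ->]]]]].
exact/conversion_subst/(sym_conversion sub).
Qed.

Lemma rstep_sym_conversion E R Z s t : E `<=` Z -> R `<=` Z ->
  rstep (R `|` sym E) s t -> conversion Z s t.
Proof.
move=> EZ RZ; apply: rstep_conversion => l r [|].
  exact: sub_conversion.
exact: sym_conversion.
Qed.

Lemma simplify_conversion E R Z s t : E `<=` Z -> R `<=` Z ->
  rstep R s t \/ pe_ostep gt E s t -> conversion Z s t.
Proof.
move=> EZ RZ st; apply: (rstep_sym_conversion EZ RZ).
case: st => [|/pe_ostep_rstep]; apply: rstep_sub.
  exact: subsetUl.
exact: subsetUr.
Qed.

Lemma KBo_sound E R E' R' l r : KBo gt (E, R) (E', R') ->
  (E' `|` R') (l, r) -> conversion (E `|` R) l r.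
Proof.
move eqp: (E, R) => p; move eqq: (E', R') => q step.
case: p q / step eqp eqq => [E1 R1 w a b wa wb|E1 R1 a b _ ab|E1 R1 a b _ ba|
  E1 R1 a _|E1 R1 a b c _ bc|E1 R1 a b c _ ac|E1 R1 a b c _ bc|
  E1 R1 a b c _ ac] [-> ->] [-> ->] {E R E' R'}; set Z := (X in conversion X).
all: have base e : Z e -> conversion Z e.1 e.2
  by case: e => l' r' Ze; apply: (@sub_conversion Z).
all: have E1Z : E1 `<=` Z by move=> e E1e; rewrite /Z/=; tauto.
all: have R1Z : R1 `<=` Z by move=> e R1e; rewrite /Z/=; tauto.
all: case=> [lr|lr].
all: try by apply: (base (l, r)); rewrite /Z /= in lr *; tauto.
- case: lr => [/E1Z/base //|[-> ->]].
  apply: rt_trans (rstep_sym_conversion E1Z R1Z wb).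
  exact/conversion_sym/(rstep_sym_conversion E1Z R1Z wa).
- case: lr => [/R1Z/base //|[-> ->]].
  by apply/conversion_sym/(base (a, b)); left; right.
- case: lr => [/R1Z/base //|[-> ->]].
  apply: rt_trans (base (a, b) _) _; first by right; right.
  apply: rstep_conversion bc => l' r' [|]; first exact: ordered_conversion.
  exact: sub_conversion.
- case: lr => [/E1Z/base //|[-> ->]].
  apply: rt_trans (base (a, b) _); last by left; right.
  exact/conversion_sym/(simplify_conversion E1Z R1Z).
- case: lr => [/E1Z/base //|[-> ->]].
  apply: rt_trans (base (a, b) _) _; first by left; right.
  exact: simplify_conversion bc.
- case: lr => [/E1Z/base //|[-> ->]].
  apply: rt_trans (base (a, b) _); last by right; right.
  apply/conversion_sym/(simplify_conversion E1Z R1Z).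
  by case: ac => [/pe_step_rstep|]; [left|right].
Qed.

(** Orienting requires the decrease, and composing lowers a right-hand side further. *)
Lemma KBo_gt E R E' R' : KBo gt (E, R) (E', R') ->
  (forall l r, R (l, r) -> gt l r) -> forall l r, R' (l, r) -> gt l r.
Proof.
move eqp: (E, R) => p; move eqq: (E', R') => q step.
case: p q / step eqp eqq => [E1 R1 w a b wa wb|E1 R1 a b _ ab|E1 R1 a b _ ba|
  E1 R1 a _|E1 R1 a b c _ bc|E1 R1 a b c _ ac|E1 R1 a b c _ bc|
  E1 R1 a b c _ ac] [_ ->] [_ ->] {E R E' R'} R_gt l r; try exact: R_gt.
- by case=> [/R_gt|[-> ->]].
- by case=> [/R_gt|[-> ->]].
- case=> [lr|[-> ->]]; first by apply: R_gt; left.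
  have ab : gt a b by apply: R_gt; right.
  apply: (gt_trans gt_reduction) ab _.
  apply: (rstep_gt gt_reduction _ bc) => l' r' [/ordered_gt//|lr'].
  by apply: R_gt; left.
- by move=> lr; apply: R_gt; left.
Qed.

(** The cases are delete, orient and the two forms of simplify. Allowing all of [E] in the
    simplifying step is harmless, since that step is later controlled by proper encompassment. *)
Lemma KBo_E_removed E R E' R' s t : KBo gt (E, R) (E', R') ->
  E (s, t) -> ~ E' (s, t) ->
  [\/ s = t, R' (s, t) \/ R' (t, s),
      exists2 u, E' (u, t) & rstep R s u \/ pe_ostep gt E s u |
      exists2 u, E' (s, u) & rstep R t u \/ pe_ostep gt E t u].
Proof.
move eqp: (E, R) => p; move eqq: (E', R') => q step.
case: p q / step eqp eqq => [E1 R1 w a b wa wb|E1 R1 a b _ ab|E1 R1 a b _ ba|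
  E1 R1 a _|E1 R1 a b c _ bc|E1 R1 a b c _ ac|E1 R1 a b c _ bc|
  E1 R1 a b c _ ac] [-> ->] [-> ->] {E R E' R'} Est nE'st.
all: try by case: nE'st.
all: try by case: nE'st; left.
all: case: Est => [?|[? ?]]; subst; try by case: nE'st; try left.
- by apply: Or42; left; right.
- by apply: Or42; right; right.
- exact: Or41.
- apply: Or43; exists c; first by right.
  case: ac => [|ac]; [by left|right].
  by apply: pe_ostep_sub ac; apply: subsetUl.
- apply: Or44; exists c; first by right.
  case: bc => [|bc]; [by left|right].
  by apply: pe_ostep_sub bc; apply: subsetUl.
Qed.

(** The two cases are compose and collapse. *)
Lemma KBo_R_removed E R E' R' s t : KBo gt (E, R) (E', R') ->
  R (s, t) -> ~ R' (s, t) ->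
  (exists2 u, R' (s, u) & rstep (ordered gt E `|` R) t u) \/
  (exists2 u, E' (u, t) & pe_step R s u \/ pe_ostep gt E s u).
Proof.
move eqp: (E, R) => p; move eqq: (E', R') => q step.
case: p q / step eqp eqq => [E1 R1 w a b wa wb|E1 R1 a b _ ab|E1 R1 a b _ ba|
  E1 R1 a _|E1 R1 a b c _ bc|E1 R1 a b c _ ac|E1 R1 a b c _ bc|
  E1 R1 a b c _ ac] [-> ->] [-> ->] {E R E' R'} Rst nR'st.
all: try by case: nR'st.
all: try by case: nR'st; left.
all: case: Rst => [?|[? ?]]; subst; try by case: nR'st; try left.
- left; exists c; first by right.
  by apply: rstep_sub bc => e [|]; [left|right; left].
- right; exists c; first by right.
  case: ac => [ac|]; [left|by right].
  by apply: pe_step_sub ac; apply: subsetUl.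
Qed.

Lemma gt_enc_gt a s t : gt_enc gt a s -> gt s t -> gt_enc gt a t.
Proof.
move=> [[a' aa' a's]|[as_ _]] st; left; last exact: enc_gt st.
have [a'' a'a'' a''t] := enc_gt gt_reduction a's st.
by exists a'' => //; apply: (gt_trans gt_reduction) aa' a'a''.
Qed.

Lemma encompasses_gt_enc a s t : encompasses a s -> gt s t -> gt_enc gt a t.
Proof. by move=> as_ /(enc_gt gt_reduction as_); left. Qed.

(** * Connectedness of the equations and rules of a run *)

Variables (E R : nat -> pairs).
Hypothesis run : KBo_run gt E R.
Hypothesis R0_empty : R 0 = set0.

Lemma run_gt i l r : R i (l, r) -> gt l r.
Proof.
elim: i l r => [|i IH]; first by rewrite R0_empty.
exact: KBo_gt (run i) IH.
Qed.

Lemma persistent_gt l r : persistent R (l, r) -> gt l r.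
Proof. by move=> [i _ Ri]; apply: (@run_gt i); apply: Ri => /=. Qed.

(** This yields one inclusion of the two conversion relations; the other comes from
    [equation_connected]. *)
Lemma run_sound i s t :
  conversion (E i `|` R i) s t -> conversion (E 0) s t.
Proof.
elim: i s t => [|i IH] s t; first by rewrite R0_empty setU0.
by move=> /(conversion_sub (fun l r => KBo_sound (run i) (r := r))) /IH.
Qed.

Hypothesis E_vanishes : persistent E = set0.
Local Notation conn := (connected gt (persistent R)).

(** Both sides of the equation used are below [s] in [gt_enc]: [l] is properly encompassed by [s],
    and [r] is encompassed by [u], which is below [s] in [gt]. *)
Lemma pe_ostep_connected Y s u :
  (forall l r, Y (l, r) -> gt_enc gt s l -> gt_enc gt s r -> conn l r) ->
  pe_ostep gt Y s u -> gt s u /\ conn s u.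
Proof.
move=> Yconn [l [r [C [σ [lr sE uE gt_lr enc]]]]].
have gt_su : gt s u by rewrite sE uE; apply: (gt_fill gt_reduction).
split=> //.
have sl : gt_enc gt s l by right.
have sr : gt_enc gt s r by left; exists u => //; rewrite uE; apply: encompasses_fill.
have lr_conn : conn l r.
  case: lr => [lr|rl]; first exact: Yconn.
  by apply: connected_sym; apply: Yconn.
rewrite sE uE; apply: (connected_fill gt_reduction).
exact: (connected_subst gt_reduction).
Qed.

Lemma rule_step_connected Y s u : (forall l r, Y (l, r) -> gt l r) ->
  (forall l r, Y (l, r) -> encompasses s l -> conn l r) ->
  rstep Y s u -> gt s u /\ conn s u.
Proof.
move=> Ygt Yconn su; split; first exact: rstep_gt gt_reduction _ Ygt _ _ su.
move: su => [l [r [C [σ [lr sE ->]]]]].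
have lr_conn : conn l r by apply: Yconn lr _; rewrite sE; apply: encompasses_fill.
rewrite sE; apply: (connected_fill gt_reduction).
exact: (connected_subst gt_reduction).
Qed.

(** Encompassment need not be proper here, so that a rule obtained by orienting an equation with
    side [a] is covered. *)
Definition rules_connected a : Prop :=
  forall i s t, R i (s, t) -> encompasses a s -> conn s t.

(** [D] is taken to be the terms below some [a] during the induction, and all terms at its end. *)
Definition equations_connected (D : tm -> Prop) : Prop :=
  forall i s t, E i (s, t) -> D s -> D t -> conn s t.

(** Every equation is removed at some stage. Deletion is trivial, orientation gives a connected
    rule, and simplification gives an equation with one side smaller in [gt], still in [D]; nested
    induction on both sides concludes. *)
Lemma equations_step (D : tm -> Prop) :
  (forall s t, D s -> gt s t -> D t) ->
  (forall s, D s -> rules_connected s /\ equations_connected (gt_enc gt s)) ->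
  equations_connected D.
Proof.
move=> Dgt IH i s t; move: s t i.
elim/(well_founded_ind (gt_wf gt_reduction)) => s IHs.
elim/(well_founded_ind (gt_wf gt_reduction)) => t IHt i Est Ds Dt.
have [|k Ek nEk] := persistent_removed Est; first by rewrite E_vanishes.
have simp v u : D v -> rstep (R k) v u \/ pe_ostep gt (E k) v u ->
    gt v u /\ conn v u.
  move=> /IH[rules eqs] [].
    apply: rule_step_connected => [|l r lr]; first exact: run_gt.
    exact: rules lr.
  by apply: pe_ostep_connected => l r; apply: eqs.
case: (KBo_E_removed (run k) Ek nEk) => [->|[st|ts]|[u Eut]|[u Esu]].
- exact: connected_refl.
- exact: (IH s Ds).1 st (encompasses_refl s).
- exact: connected_sym ((IH t Dt).1 _ _ _ ts (encompasses_refl t)).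
- move=> /(simp s u Ds)[gt_su su]; apply: (connected_step gt_reduction gt_su su).
  by apply: IHs Eut _ Dt => //; apply: Dgt gt_su.
- move=> /(simp t u Dt)[gt_tu tu]; apply: connected_sym.
  apply: (connected_step gt_reduction gt_tu tu); apply: connected_sym.
  by apply: IHt Esu Ds _ => //; apply: Dgt gt_tu.
Qed.

(** By induction on [gt_enc], equations with both sides below [a] come first, from the hypotheses at
    those sides. Rules with left-hand side encompassed by [a] follow, by an inner induction on the
    right-hand side. *)
Lemma run_connected a : rules_connected a /\ equations_connected (gt_enc gt a).
Proof.
elim/(well_founded_ind (gt_enc_wf gt_reduction)): a => a IH.
have eqs : equations_connected (gt_enc gt a).
  by apply: equations_step IH => s t; apply: gt_enc_gt.
split=> // i s t; move: t i.
elim/(well_founded_ind (gt_wf gt_reduction)) => t IHt i Rst as_.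
have [pers|npers] := pselect (persistent R (s, t)).
  exact: (rstep_connected gt_reduction persistent_gt (rstep_rule pers)).
have [k Rk nRk] := persistent_removed Rst npers.
have gt_st := run_gt Rst.
have at_ : gt_enc gt a t := encompasses_gt_enc as_ gt_st.
case: (KBo_R_removed (run k) Rk nRk) => [[u Rsu]|[u Eut]].
  (* Compose: the new rule has a smaller right-hand side, and whatever rewrites [t] is connected
     because [t] is below [a]. *)
  move=> tu; suff [gt_tu conn_tu] : gt t u /\ conn t u.
    apply: connected_sym; apply: (connected_step gt_reduction gt_tu conn_tu).
    by apply: connected_sym; apply: IHt Rsu as_.
  move: tu => [l [r [C [σ [+ tE uE]]]]].
  case=> [[l' [r' [τ [lr gt_lr [lE rE]]]]]|lr].
    have tl' : encompasses t l'.
      by rewrite tE lE subst_subst; apply: encompasses_fill.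
    have gt_tu : gt t u.
      rewrite tE uE lE rE.
      exact/(gt_fill gt_reduction)/(gt_subst gt_reduction)/gt_lr.
    have ul' : encompasses u r'.
      by rewrite uE rE subst_subst; apply: encompasses_fill.
    have al' := gt_enc_enc at_ tl'; have ar' := gt_enc_enc (gt_enc_gt at_ gt_tu) ul'.
    have conn_lr : conn l' r'.
      case: lr => [lr|rl]; first exact: eqs lr al' ar'.
      exact: connected_sym (eqs _ _ _ rl ar' al').
    split=> //; rewrite tE uE lE rE; apply: (connected_fill gt_reduction).
    by do 2 apply: (connected_subst gt_reduction).
  apply: (rule_step_connected (@run_gt k)).
    by move=> l' r'; apply: (IH t at_).1.
  by exists l, r, C, σ.
(* Collapse: both sides of the new equation are below the left-hand side [s] in [gt], hence below
   [a], so [eqs] applies. Proper encompassment puts the collapsing rule or equation below [a]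
   too. *)
move=> su; suff [gt_su conn_su] : gt s u /\ conn s u.
  apply: (connected_step gt_reduction gt_su conn_su).
  exact: eqs Eut (encompasses_gt_enc as_ gt_su) at_.
case: su => [[l [r [C [σ [lr sE uE sl]]]]]|su].
  have conn_lr : conn l r.
    apply: (IH l _).1 lr (encompasses_refl l).
    by right; apply: encompasses_properly as_ sl.
  rewrite sE uE; split.
    exact/(gt_fill gt_reduction)/(gt_subst gt_reduction)/(run_gt lr).
  exact/(connected_fill gt_reduction)/(connected_subst gt_reduction).
apply: pe_ostep_connected su => l r lr sl sr.
by apply: eqs lr _ _; apply: (enc_gt_enc gt_reduction) as_ _.
Qed.

Lemma equation_connected i s t : E i (s, t) -> conn s t.
Proof.
move=> Est; apply: (@equations_step (fun=> True)) Est _ _ => // v _.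
exact: run_connected.
Qed.

End Inference.

Theorem theorem7p17 (F : signature) (V : Type)
    (V_infinite : infinite_set [set: V])
    (gt : relation (term F V))
    (gt_reduction : reduction_order gt)
    (gt_ground_total : ground_total gt)
    (E R : nat -> set (term F V * term F V))
    (run : KBo_run gt E R)
    (R0_empty : R 0 = set0)
    (run_fair : fair gt E R)
    (Eomega_empty : persistent E = set0) :
  complete_presentation (persistent R) (E 0).
Proof.
have R_gt := persistent_gt gt_reduction run R0_empty.
have E_conn := equation_connected gt_reduction run R0_empty Eomega_empty.
split.
  split; first exact: gt_is_TRS gt_reduction _ R_gt.
    elim/(well_founded_ind (gt_wf gt_reduction)) => s IH.
    by constructor=> t /(rstep_gt gt_reduction R_gt); apply: IH.
  apply: (PCP_confluent gt_reduction R_gt V_infinite) => s t pcp.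
  (* A prime critical pair is either joinable by persistent rules or one step of an equation of the
     run; both make it connected. *)
  have := run_fair s t; rewrite Eomega_empty set0U => /(_ pcp)[|].
    have -> : ordered gt set0 = set0 :> set (term F V * term F V).
      by apply/seteqP; split=> // e [l [r [σ [[]]]]].
    by rewrite set0U; apply: (joinable_connected gt_reduction).
  by apply: (sstep_connected gt_reduction) => l r [i _]; apply: E_conn.
move=> s t; split; apply: conversion_sub => l r.
  move=> [i _ Ri]; apply: (run_sound run R0_empty (i := i)).
  apply: rt_step; left; apply: rstep_rule; right; exact: Ri (leqnn i).
by move=> /E_conn /conversion_inW.
Qed.
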